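(* For every $d\geq 2$, there is a set $E\subseteq\mathbb{Z}^d$ with positive upper Banach density such that $$\{\operatorname{tr}(A_{\mathbf v}):\mathbf v=(v_0,\ldots,v_d)\in E^{d+1}\text{ and }v_0,\ldots,v_d\text{ are affinely independent}\}$$ does not contain any finite-index subgroup of $\mathbb{Z}$.
   Context: For $E\subseteq\mathbb{Z}^d$, the upper Banach density is $d^*(E)=\limsup_{N\to\infty}\sup_{t\in\mathbb{Z}^d}\frac{|E\cap(t+[-N,N]^d)|}{|[-N,N]^d|}$, where $[-N,N]^d$ denotes the set of integer points in the box. For an ordered tuple $\mathbf v=(v_0,\ldots,v_d)$ of vectors in $\mathbb{R}^d$, the edge matrix $A_{\mathbf v}=[\,v_1-v_0\ \cdots\ v_d-v_0\,]$ is the $d\times d$ matrix with columns $v_j-v_0$. *)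

(* Defs.v *)
From mathcomp Require Import all_boot all_order all_algebra.
From mathcomp Require Import finmap.
From mathcomp Require Import all_classical all_reals all_analysis.
Import Order.TTheory GRing.Theory Num.Theory.

Set Implicit Arguments.
Unset Strict Implicit.
Unset Printing Implicit Defensive.

Local Open Scope classical_set_scope.
Local Open Scope ring_scope.

Definition int_box (d N : nat) : set 'cV[int]_d :=
  [set x | forall i, - N%:Z <= x i 0 <= N%:Z].
Arguments int_box : clear implicits.

Definition translate (V : zmodType) (t : V) (A : set V) : set V :=
  [set t + x | x in A].

(* [fset_set] is [fset0] on infinite sets; the two lemmas below show that
   [upper_banach_density] only applies it to finite ones. *)
Lemma finite_int_box d N : finite_set (int_box d N).
Proof.
pose f (g : {ffun 'I_d -> 'I_(N + N).+1}) : 'cV[int]_d :=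
  \col_i ((g i : nat)%:Z - N%:Z).
apply: (@sub_finite_set _ _ (f @` setT)); last first.
  by apply: finite_image; exact: finite_finset.
move=> x xN; exists [ffun i => inord (absz (x i 0 + N%:Z))] => //.
apply/colP => i; rewrite mxE ffunE.
have /andP[lex gex] := xN i.
have x0 : 0 <= x i 0 + N%:Z by rewrite -lerBlDr sub0r.
have ltx : (absz (x i 0 + N%:Z)%R < (N + N).+1)%N.
  by rewrite ltnS -lez_nat gez0_abs // PoszD lerD2r.
by rewrite inordK // gez0_abs // addrK.
Qed.

Lemma finite_setI_translate_int_box d N (t : 'cV[int]_d) (E : set 'cV[int]_d) :
  finite_set (E `&` translate t (int_box d N)).
Proof.
by apply: finite_setIr; apply: finite_image; exact: finite_int_box.
Qed.

Definition upper_banach_density (R : realType) (d : nat)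
    (E : set 'cV[int]_d) : \bar R :=
  limn_esup (fun N : nat =>
    ereal_sup (range (fun t : 'cV[int]_d =>
      (#|` fset_set (E `&` translate t (int_box d N))|%:R
        / #|` fset_set (int_box d N)|%:R)%:E))).

Definition affinely_independent (K : fieldType) (V : lmodType K)
    (I : finType) (v : I -> V) : Prop :=
  forall c : I -> K,
    \sum_i c i = 0 -> \sum_i c i *: v i = 0 -> forall i, c i = 0.

(* Stated over any [zmodType], so that the edge matrix of a tuple of integer
   points is an integer matrix and its trace an element of [int]. *)
Definition edge_matrix (K : zmodType) (d : nat)
    (v : 'I_d.+1 -> 'cV[K]_d) : 'M[K]_d :=
  \matrix_(i, j) (v (lift ord0 j) i 0 - v ord0 i 0).

Definition edge_trace_set (R : realType) (d : nat)
    (E : set 'cV[int]_d) : set int :=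
  [set \tr (edge_matrix v) | v in
    [set v : 'I_d.+1 -> 'cV[int]_d | (forall i, E (v i)) /\
      affinely_independent (fun i => map_mx intr (v i) : 'cV[R]_d)]].

Definition finite_index_subgroup (V : zmodType) (H : set V) : Prop :=
  zmod_closed [in H] /\ finite_set (range (fun a : V => translate a H)).

(* Main.v *)
Require Import Defs.
From mathcomp Require Import finmap.
From mathcomp Require Import all_boot all_order all_algebra.
From mathcomp Require Import all_classical all_reals all_analysis.
From mathcomp Require Import pi_irrational lra zify.
Import Order.TTheory GRing.Theory Num.Theory.

(** The trace of an edge matrix is the sum over [j] of the differences
    [(v_(j+1))_j - (v_0)_j], so it only compares each coordinate of a vertex with the
    same coordinate of the base vertex.  Cut the circle [R/Z] into
    [M = 4 d + 1] arcs of length [1/M] and colour a point of [Z^d] by the arcs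
    that contain [pi * x_0, ..., pi * x_(d-1)] modulo 1.  There are finitely
    many colours, so some colour class [E] has positive upper Banach density
    ([preimage_density_gt0]).  For vertices in [E] each coordinate difference,
    multiplied by [pi], is within [1/M] of an integer ([same_cell_near_int]),
    so [pi * t] is within [d/M < 1/4] of an integer for every trace [t].

    A finite-index subgroup of [Z] contains all multiples of some [k > 0]
    ([finite_index_multiples]).  If all of them were traces, every
    [2^n * (pi * k)] would be within [1/4] of an integer.  Since doubling a real
    that is within [1/4] of an integer doubles its distance to the integers,
    this forces [pi * k] to be an integer ([near_int_doublings]), against the
    irrationality of [pi]. *)

Local Open Scope classical_set_scope.
Local Open Scope ring_scope.

Lemma card_fset_set_preimages (T : choiceType) (C : finType) (c : T -> C)
    (A : set T) : finite_set A ->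
  #|` fset_set A| = (\sum_a #|` fset_set (c @^-1` [set a] `&` A)|)%N.
Proof.
move=> finA; rewrite (card_fset_sum1 (fset_set A)).
rewrite (partition_big c predT) //=; apply: eq_bigr => a _.
have -> : fset_set (c @^-1` [set a] `&` A) =
    [fset x in fset_set A | c x == a]%fset.
  apply/fsetP => x; rewrite !inE /= !in_fset_set//; last by apply: finite_setIr.
  apply/idP/andP => [/set_mem[/= /eqP ? ?]|[/set_mem ? /eqP ?]].
    by split=> //; apply/mem_set.
  exact/mem_set.
by rewrite card_fset_sum1 big_fset.
Qed.

(** In a given box the relative frequencies of the colours sum to 1.  If all
    classes had density 0, then in some large box each frequency would be less
    than [1/#|C|]: finitely many eventual bounds hold simultaneously. *)
Lemma preimage_density_gt0 (R : realType) (d : nat) (C : finType)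
    (c : 'cV[int]_d -> C) :
  exists a, (0 < upper_banach_density R (c @^-1` [set a]))%E.
Proof.
apply: contrapT => /forallNP no_a.
have C_gt0 : (0 < #|C|)%N by apply/card_gt0P; exists (c 0).
pose u a N := #|` fset_set (c @^-1` [set a] `&` int_box d N)|.
have small a : \forall N \near \oo,
    (u a N)%:R / #|` fset_set (int_box d N)|%:R < #|C|%:R^-1 :> R.
  have /ereal_inf_lt[_ [V V_near <-] V_lt] :
      (upper_banach_density R (c @^-1` [set a]) < (#|C|%:R^-1)%:E)%E.
    move/negP: (no_a a); rewrite -leNgt => /le_lt_trans; apply.
    by rewrite lte_fin invr_gt0 ltr0n.
  apply: filterS V_near => N VN; rewrite -lte_fin; apply: le_lt_trans V_lt.
  apply: le_trans; last by apply: ereal_sup_ubound; exists N.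
  apply: ereal_sup_ubound; exists 0 => //; rewrite /u.
  suff -> : translate 0 (int_box d N) = int_box d N by [].
  apply/seteqP; split=> [_ [x xN <-]|x xN]; first by rewrite add0r.
  by exists x; rewrite ?add0r.
have [N uN_lt] := filter_ex (filter_forall _ small).
have box_gt0 : (0 < #|` fset_set (int_box d N)|)%N.
  rewrite cardfs_gt0; apply/fset0Pn; exists 0.
  rewrite in_fset_set; last exact: finite_int_box.
  by rewrite inE => i; rewrite mxE; apply/andP; split; rewrite ?oppr_le0.
have : \sum_a (u a N)%:R / #|` fset_set (int_box d N)|%:R
         < \sum_(a : C) #|C|%:R^-1 :> R.
  by apply: ltr_sum => //; apply/hasP; exists (c 0); rewrite ?mem_index_enum.
rewrite -mulr_suml -natr_sum.
rewrite -(card_fset_set_preimages _ _ c); last exact: finite_int_box.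
by rewrite sumr_const -[ltRHS]mulr_natl !divff ?ltxx // pnatr_eq0 -lt0n.
Qed.

(** Let [m0] be the integer near [b].  Inductively [2^n m0] is the integer near
    [2^n b]: at the next step the distance is at most doubled, hence below 1/2,
    while some integer is within 1/4, and two integers at distance less than 1
    coincide.  So [2^n |b - m0| < 1/4] for all [n], whence [b = m0]. *)
Lemma near_int_doublings (R : realType) (b : R) :
  (forall n, exists m : int, `|2 ^+ n * b - m%:~R| < 4^-1) ->
  exists m : int, b = m%:~R.
Proof.
move=> near_int; have [m0] := near_int 0%N; rewrite expr0 mul1r => b_m0.
have doubled n : `|2 ^+ n * (b - m0%:~R)| < 4^-1.
  elim: n => [|n IHn]; first by rewrite mul1r.
  have [m] := near_int n.+1.
  have eq_dist : 2 ^+ n.+1 * b - m%:~R =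
      2 * (2 ^+ n * (b - m0%:~R)) - (m - 2 ^+ n.+1 * m0)%:~R.
    rewrite rmorphB rmorphM rmorphXn /= exprS; lra.
  rewrite mulrBr -{1}[_ * b](subrK m%:~R) => lt_m.
  suff eq_m : m = 2 ^+ n.+1 * m0.
    rewrite eq_m rmorphM rmorphXn /= in lt_m.
    by move: lt_m; rewrite subrK.
  have : -1 < m - 2 ^+ n.+1 * m0 < 1.
    rewrite -!(ltr_int R); move: lt_m IHn.
    rewrite eq_dist !ltr_norml => /andP[? ?] /andP[? ?].
    by apply/andP; split; lra.
  by move: (2 ^+ _ * _) => z; lia.
exists m0; apply/eqP; rewrite -subr_eq0 -normr_le0; apply/negP => /negP.
rewrite -ltNge => dist_gt0.
have := doubled (Num.bound (`|b - m0%:~R|^-1)).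
rewrite normrM ger0_norm ?exprn_ge0// -ltr_pdivlMr// => lt_inv.
have inv_gt0 : 0 < `|b - m0%:~R|^-1 by rewrite invr_gt0.
have := archi_boundP (ltW inv_gt0); set n := Num.bound _ => n_gt.
have : n%:R < 2 ^+ n :> R by rewrite -natrX ltr_nat ltn_expl.
by move: lt_inv; lra.
Qed.

(** By the pigeonhole principle two of the cosets [i + H], [i] a natural number,
    coincide, and [k] is the difference of their representatives. *)
Lemma finite_index_multiples (H : set int) : finite_index_subgroup H ->
  exists2 k : nat, (0 < k)%N & forall n : nat, H (n * k)%N%:Z.
Proof.
case=> subH finH; have [H0 HD] := GRing.zmod_closed0D subH.
have [i [j [ij eqH]]] : exists i j : nat,
    (i < j)%N /\ translate i%:Z H = translate j%:Z H.
  apply: contrapT => no_ij; apply: infinite_nat.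
  pose f (i : nat) := translate i%:Z H.
  have f_inj : injective f.
    move=> i j fij; case: (ltngtP i j) => // lt_ij; exfalso; apply: no_ij.
      by exists i, j.
    by exists j, i.
  suff : finite_set (range f).
    by rewrite (eq_finite_set (inj_card_eq (in2W f_inj))).
  by apply: sub_finite_set finH => _ [i _ <-]; exists i%:Z.
have : translate i%:Z H j%:Z.
  by rewrite eqH; exists 0; rewrite ?addr0//; exact: set_mem.
case=> h Hh ihj; have hE : h = (j - i)%N%:Z by lia.
exists (j - i)%N; first by rewrite subn_gt0.
elim=> [|n IHn]; first exact: set_mem.
by rewrite mulSn PoszD; apply: set_mem; apply: HD; apply/mem_set; rewrite -?hE.
Qed.

(** The residue mod [M] of the floor of [M a x] is the index of the arc of
    length [1/M] of [R/Z] that contains [a x]; two points in the same arc are at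
    distance less than [1/M], and [m] is the difference of the floors divided
    by [M]. *)
Lemma same_cell_near_int (R : realType) (M : nat) (a : R) (x y : int) :
  (0 < M)%N ->
  (Num.floor (M%:R * a * x%:~R) = Num.floor (M%:R * a * y%:~R) %[mod M])%Z ->
  exists m : int, `|a * (x - y)%:~R - m%:~R| < M%:R^-1.
Proof.
move=> M_gt0; set fx := Num.floor _; set fy := Num.floor _ => /eqP.
rewrite eqz_mod_dvd => /dvdzP[m fE]; exists m.
have MR_gt0 : 0 < M%:R :> R by rewrite ltr0n.
have := floor_itv (M%:R * a * x%:~R); have := floor_itv (M%:R * a * y%:~R).
rewrite -/fx -/fy !intrD => /andP[? ?] /andP[? ?].
have : fx%:~R - fy%:~R = m%:~R * M%:R :> R by rewrite -rmorphB fE rmorphM.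
rewrite -(ltr_pM2l MR_gt0) mulfV ?gt_eqF// -[X in X * `|_|]gtr0_norm// -normrM.
by rewrite intrN ltr_norml => ?; apply/andP; split; lra.
Qed.

Theorem mainTheorem4 (R : realType) (d : nat) (d_ge2 : (2 <= d)%N) :
  exists E : set 'cV[int]_d,
    (0 < upper_banach_density R E)%E /\
    ~ (exists H : set int,
         finite_index_subgroup H /\ H `<=` edge_trace_set R E).
Proof.
pose M := (4 * d).+1.
pose c (x : 'cV[int]_d) : {ffun 'I_d -> 'I_M} :=
  [ffun i => inord (absz (Num.floor (M%:R * pi * (x i 0)%:~R : R) %% M)%Z)].
have mod_lt z : (absz (z %% M)%Z < M)%N.
  have := ltz_pmod z (isT : 0 < M%:Z).
  by have := modz_ge0 z (isT : M%:Z != 0); lia.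
have [a a_gt0] := preimage_density_gt0 R _ _ c.
exists (c @^-1` [set a]); split=> // -[H [H_fin H_sub]].
have [k k_gt0 Hk] := finite_index_multiples H H_fin.
have [|m] := near_int_doublings R (pi * k%:R).
  move=> n; have [v [Ev _] tr_v] := H_sub _ (Hk (2 ^ n)%N).
  have cell j : exists m : int,
      `|pi * (edge_matrix v j j)%:~R - m%:~R| < M%:R^-1 :> R.
    rewrite mxE; apply: same_cell_near_int => //.
    have /ffunP/(_ j) : c (v (lift ord0 j)) = c (v ord0) by rewrite !Ev.
    rewrite !ffunE => /(congr1 val) /=; rewrite !inordK // => /(congr1 Posz).
    by rewrite !gez0_abs ?modz_ge0.
  have /choice[m mP] := cell; exists (\sum_j m j).
  have -> : 2 ^+ n * (pi * k%:R) - (\sum_j m j)%:~R =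
      \sum_j (pi * (edge_matrix v j j)%:~R - (m j)%:~R) :> R.
    rewrite sumrB -mulr_sumr -!rmorph_sum /= -/(\tr _) tr_v PoszM /=.
    rewrite -pmulrn natrM natrX; lra.
  apply: (le_lt_trans (ler_norm_sum _ _ _)).
  apply: (@le_lt_trans _ _ (\sum_(j < d) M%:R^-1)).
    by apply: ler_sum => j _; exact: ltW.
  rewrite sumr_const card_ord -[ltLHS]mulr_natl ltr_pdivrMr ?ltr0n//.
  have -> : M%:R = 4 * d%:R + 1 :> R by rewrite /M -[LHS]natr1 natrM.
  by lra.
move=> pi_kE; apply: (@pi_irrationnal R); apply/rationalP; exists m, k.
by rewrite -pi_kE mulfK// pnatr_eq0 -lt0n.
Qed.
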